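(* With $F$, $G$, $\mathcal{A}$, $\mathcal{B}$ and condition $(\ast)$ as defined in the context: (i) If $(X;\sim,\backsim,\wedge,1)$ is a pseudo equality algebra, then $F(G(F((X;\sim,\backsim,\wedge,1))))=F((X;\sim,\backsim,\wedge,1))$. (ii) If $(X;\to,\rightsquigarrow,\wedge,1)$ is a pseudo $BCK$-meet-semilattice satisfying $(\ast)$, then $F(G((X;\to,\rightsquigarrow,\wedge,1)))=(X;\to,\rightsquigarrow,\wedge,1)$. (iii) A pseudo equality algebra $(X;\sim,\backsim,\wedge,1)$ is invariant if and only if $G(F((X;\sim,\backsim,\wedge,1)))=(X;\sim,\backsim,\wedge,1)$. (iv) The class of pseudo $BCK$-meet-semilattices satisfying $(\ast)$ and the class of invariant pseudo equality algebras are term equivalent. (v) The category $Inv(\mathcal{A})$ of invariant pseudo equality algebras and the category $\mathcal{B}$ are categorically equivalent.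
   Context: A pseudo equality algebra is an algebra $(X;\sim,\backsim,\wedge,1)$ of type $(2,2,2,0)$ such that for all $a,b,c\in X$ (with $x\le y$ iff $x\wedge y=x$): (F1) $(X;\wedge,1)$ is a meet-semilattice with top element $1$; (F2) $a\sim a=1=a\backsim a$; (F3) $a\sim 1=a=1\backsim a$; (F4) $a\leq b\leq c$ implies $a\sim c\leq b\sim c$, $a\sim c\leq a\sim b$, $c\backsim a\leq c\backsim b$ and $c\backsim a\leq b\backsim a$; (F5) $a\sim b\leq (a\wedge c)\sim (b\wedge c)$ and $a\backsim b\leq (a\wedge c)\backsim (b\wedge c)$; (F6) $a\sim b\leq (c\sim a)\backsim (c\sim b)$ and $a\backsim b\leq (a\backsim c)\sim (b\backsim c)$; (F7) $a\sim b\leq (a\sim c)\sim (b\sim c)$ and $a\backsim b\leq (c\backsim a)\backsim (c\backsim b)$. A pseudo $BCK$-algebra is an algebra $(X;\to,\rightsquigarrow,1)$ of type $(2,2,0)$ such that for all $a,b,c\in X$: (PBCK1) $(a\to b)\rightsquigarrow ((b\to c)\rightsquigarrow (a\to c))=1$ and $(a\rightsquigarrow b)\to ((b\rightsquigarrow c)\to (a\rightsquigarrow c))=1$; (PBCK2) $1\to a=a$ and $1\rightsquigarrow a=a$; (PBCK3) $a\to 1=1$ and $a\rightsquigarrow 1=1$; (PBCK4) $a\to b=1=b\to a$ implies $a=b$, and $a\rightsquigarrow b=1=b\rightsquigarrow a$ implies $a=b$. In a pseudo $BCK$-algebra, $a\leq b$ iff $a\to b=1$ (equivalently, iff $a\rightsquigarrow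 b=1$) defines a partial order. A pseudo $BCK$-meet-semilattice is an algebra $(X;\to,\rightsquigarrow,\wedge,1)$ of type $(2,2,2,0)$ such that $(X;\to,\rightsquigarrow,1)$ is a pseudo $BCK$-algebra whose underlying partial order is a meet-semilattice with meet operation $\wedge$. Condition $(\ast)$: $b\to a\leq (b\wedge c)\to (a\wedge c)$ and $b\rightsquigarrow a\leq (b\wedge c)\rightsquigarrow (a\wedge c)$ for all $a,b,c\in X$. $\mathcal{A}$ is the category of pseudo equality algebras and their homomorphisms; $\mathcal{B}$ is the category of pseudo $BCK$-meet-semilattices satisfying $(\ast)$ and their homomorphisms. For a pseudo equality algebra, $F((X;\sim,\backsim,\wedge,1)):=(X;\to,\rightsquigarrow,\wedge,1)$ with $a\to b=(a\wedge b)\sim a$ and $a\rightsquigarrow b=a\backsim(a\wedge b)$; this is an object of $\mathcal{B}$. For an object of $\mathcal{B}$, $G((X;\to,\rightsquigarrow,\wedge,1)):=(X;\sim',\backsim',\wedge,1)$ with $a\sim' b=b\to a$ and $a\backsim' b=a\rightsquigarrow b$; this is a pseudo equality algebra. $F:\mathcal{A}\to\mathcal{B}$ and $G:\mathcal{B}\to\mathcal{A}$ are functors (acting identically on underlying maps). A pseudo equality algebra $(X;\sim,\backsim,\wedge,1)$ is invariant if there is a pseudo $BCK$-meet-semilattice $(X;\mapsto,\rightarrowtail,\wedge,1)$ satisfying $(\ast)$ with $G((X;\mapsto,\rightarrowtail,\wedge,1))=(X;\sim,\backsim,\wedge,1)$. $Inv(\mathcal{A})$ is the category of invariant pseudo equality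 algebras and their homomorphisms. Two classes of algebras are term equivalent if the fundamental operations of the algebras of each class are definable by terms in the language of the other, uniformly over the class, so that the two resulting translations between the classes (preserving underlying sets) are mutually inverse. *)

(* Defs.v *)
From Stdlib Require Import Fin FunctionalExtensionality ProofIrrelevance.

Set Implicit Arguments.
Unset Strict Implicit.

(** * Universal algebra *)

Record signature := Signature { symbol : Type; arity : symbol -> nat }.

Fixpoint nary (X : Type) (n : nat) : Type :=
  match n with
  | 0 => X
  | S m => X -> nary X m
  end.

Fixpoint napply {X : Type} {n : nat} : nary X n -> (Fin.t n -> X) -> X :=
  match n with
  | 0 => fun f _ => f
  | S m => fun f v => napply (f (v F1)) (fun i => v (FS i))
  end.

Definition vcons {X : Type} {n : nat} (x : X) (v : Fin.t n -> X) :
    Fin.t (S n) -> X :=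
  fun i => Fin.caseS' i (fun _ => X) x v.

Fixpoint ncurry {X : Type} {n : nat} : ((Fin.t n -> X) -> X) -> nary X n :=
  match n with
  | 0 => fun f => f (Fin.case0 (fun _ => X))
  | S m => fun f x => ncurry (fun v => f (vcons x v))
  end.

Definition structure (sg : signature) (X : Type) : Type :=
  forall s : symbol sg, nary X (arity s).

Definition is_hom (sg : signature) (X Y : Type)
    (A : structure sg X) (B : structure sg Y) (f : X -> Y) : Prop :=
  forall (s : symbol sg) (v : Fin.t (arity s) -> X),
    f (napply (A s) v) = napply (B s) (fun i => f (v i)).

Definition algebra_class (sg : signature) : Type :=
  forall X : Type, structure sg X -> Prop.

Record algebra (sg : signature) (K : algebra_class sg) (X : Type) := Algebra {
  ops :> structure sg X;
  in_class : K X ops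
}.

Inductive term (sg : signature) (V : Type) : Type :=
  | Var : V -> term sg V
  | App : forall s : symbol sg, (Fin.t (arity s) -> term sg V) -> term sg V.

Fixpoint eval {sg : signature} {X V : Type} (A : structure sg X) (v : V -> X)
    (t : term sg V) : X :=
  match t with
  | Var _ x => v x
  | App args => napply (A _) (fun i => eval A v (args i))
  end.

(** A translation defines each [n]-ary symbol of [sg1] by a term of [sg2] in
    [n] variables, independently of any particular algebra. *)
Definition translation (sg1 sg2 : signature) : Type :=
  forall s : symbol sg1, term sg2 (Fin.t (arity s)).

Definition interpret {sg1 sg2 : signature} (t : translation sg1 sg2) {X : Type}
    (A : structure sg2 X) : structure sg1 X :=
  fun s => ncurry (fun v => eval A v (t s)).

Definition term_equivalent (sg1 sg2 : signature)
    (K1 : algebra_class sg1) (K2 : algebra_class sg2) : Prop :=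
  exists (t : translation sg2 sg1) (u : translation sg1 sg2),
    (forall (X : Type) (A : structure sg1 X), K1 X A -> K2 X (interpret t A)) /\
    (forall (X : Type) (B : structure sg2 X), K2 X B -> K1 X (interpret u B)) /\
    (forall (X : Type) (A : structure sg1 X), K1 X A ->
       interpret u (interpret t A) = A) /\
    (forall (X : Type) (B : structure sg2 X), K2 X B ->
       interpret t (interpret u B) = B).

(** * Categories *)

Record category := Category {
  ob :> Type;
  hom : ob -> ob -> Type;
  idm : forall x, hom x x;
  comp : forall x y z, hom y z -> hom x y -> hom x z;
  comp_idl : forall x y (f : hom x y), comp (idm y) f = f;
  comp_idr : forall x y (f : hom x y), comp f (idm x) = f;
  comp_assoc : forall w x y z (h : hom y z) (g : hom x y) (f : hom w x),
    comp h (comp g f) = comp (comp h g) f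
}.

Record functor (C D : category) := Functor {
  fob :> C -> D;
  fmap : forall x y : C, hom x y -> hom (fob x) (fob y);
  fmap_id : forall x : C, fmap (idm x) = idm (fob x);
  fmap_comp : forall (x y z : C) (g : hom y z) (f : hom x y),
    fmap (comp g f) = comp (fmap g) (fmap f)
}.

Definition functor_id (C : category) : functor C C :=
  @Functor C C (fun x => x) (fun _ _ f => f)
    (fun _ => eq_refl) (fun _ _ _ _ _ => eq_refl).

Program Definition functor_comp (C D E : category)
    (G : functor D E) (F : functor C D) : functor C E :=
  @Functor C E (fun x => G (F x)) (fun _ _ f => fmap G (fmap F f)) _ _.
Next Obligation. now rewrite !fmap_id. Qed.
Next Obligation. now rewrite !fmap_comp. Qed.

Record natural_iso (C D : category) (F G : functor C D) := NaturalIso {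
  component : forall x : C, hom (F x) (G x);
  component_inv : forall x : C, hom (G x) (F x);
  component_invl : forall x : C,
    comp (component_inv x) (component x) = idm (F x);
  component_invr : forall x : C,
    comp (component x) (component_inv x) = idm (G x);
  naturality : forall (x y : C) (f : hom x y),
    comp (component y) (fmap F f) = comp (fmap G f) (component x)
}.

Definition equivalent_categories (C D : category) : Prop :=
  exists (F : functor C D) (G : functor D C),
    inhabited (natural_iso (functor_comp G F) (functor_id C)) /\
    inhabited (natural_iso (functor_comp F G) (functor_id D)).

Section AlgebraCategory.

Variables (sg : signature) (K : algebra_class sg).

Record bundled_algebra := Bundle {
  carrier : Type;
  bundled :> algebra K carrier
}.

Record algebra_hom (A B : bundled_algebra) := AlgebraHom {
  hom_fun :> carrier A -> carrier B;
  hom_funP : is_hom A B hom_fun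
}.

Lemma algebra_hom_ext (A B : bundled_algebra) (f g : algebra_hom A B) :
  (forall x, f x = g x) -> f = g.
Proof.
destruct f as [f fP], g as [g gP]; simpl; intros E.
assert (f = g) by (now apply functional_extensionality); subst g.
now rewrite (proof_irrelevance _ fP gP).
Qed.

Definition algebra_hom_id (A : bundled_algebra) : algebra_hom A A :=
  @AlgebraHom A A (fun x => x) (fun _ _ => eq_refl).

Program Definition algebra_hom_comp (A B C : bundled_algebra)
    (g : algebra_hom B C) (f : algebra_hom A B) : algebra_hom A C :=
  @AlgebraHom A C (fun x => g (f x)) _.
Next Obligation. intros s v; now rewrite !hom_funP. Qed.

Program Definition algebra_category : category :=
  @Category bundled_algebra algebra_hom algebra_hom_id algebra_hom_comp _ _ _.
Next Obligation. now apply algebra_hom_ext. Qed.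
Next Obligation. now apply algebra_hom_ext. Qed.
Next Obligation. now apply algebra_hom_ext. Qed.

End AlgebraCategory.

(** * Pseudo equality algebras *)

Inductive eq_symbol := Sim | BackSim | EqMeet | EqOne.

Definition eq_sig : signature :=
  @Signature eq_symbol
    (fun s => match s with Sim | BackSim | EqMeet => 2 | EqOne => 0 end).

Section PseudoEquality.

Variables (X : Type) (A : structure eq_sig X).

Local Notation "a ∼ b" := (A Sim a b) (at level 50, no associativity).
Local Notation "a ∽ b" := (A BackSim a b) (at level 50, no associativity).
Local Notation "a ∧ b" := (A EqMeet a b) (at level 40, left associativity).
Local Notation "1" := (A EqOne).
Local Notation "a ≤ b" := (a ∧ b = a) (at level 70, no associativity).

Record pseudo_equality : Prop := {
  F1_comm : forall a b, a ∧ b = b ∧ a;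
  F1_assoc : forall a b c, a ∧ (b ∧ c) = a ∧ b ∧ c;
  F1_idem : forall a, a ∧ a = a;
  F1_top : forall a, a ≤ 1;
  F2l : forall a, a ∼ a = 1;
  F2r : forall a, a ∽ a = 1;
  F3l : forall a, a ∼ 1 = a;
  F3r : forall a, 1 ∽ a = a;
  F4a : forall a b c, a ≤ b -> b ≤ c -> a ∼ c ≤ b ∼ c;
  F4b : forall a b c, a ≤ b -> b ≤ c -> a ∼ c ≤ a ∼ b;
  F4c : forall a b c, a ≤ b -> b ≤ c -> c ∽ a ≤ c ∽ b;
  F4d : forall a b c, a ≤ b -> b ≤ c -> c ∽ a ≤ b ∽ a;
  F5l : forall a b c, a ∼ b ≤ (a ∧ c) ∼ (b ∧ c);
  F5r : forall a b c, a ∽ b ≤ (a ∧ c) ∽ (b ∧ c);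
  F6l : forall a b c, a ∼ b ≤ (c ∼ a) ∽ (c ∼ b);
  F6r : forall a b c, a ∽ b ≤ (a ∽ c) ∼ (b ∽ c);
  F7l : forall a b c, a ∼ b ≤ (a ∼ c) ∼ (b ∼ c);
  F7r : forall a b c, a ∽ b ≤ (c ∽ a) ∽ (c ∽ b)
}.

End PseudoEquality.

(** * Pseudo BCK-meet-semilattices *)

Record pseudo_BCK (X : Type) (imp rimp : X -> X -> X) (one : X) : Prop := {
  PBCK1l : forall a b c,
    rimp (imp a b) (rimp (imp b c) (imp a c)) = one;
  PBCK1r : forall a b c,
    imp (rimp a b) (imp (rimp b c) (rimp a c)) = one;
  PBCK2l : forall a, imp one a = a;
  PBCK2r : forall a, rimp one a = a;
  PBCK3l : forall a, imp a one = one;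
  PBCK3r : forall a, rimp a one = one;
  PBCK4l : forall a b, imp a b = one -> imp b a = one -> a = b;
  PBCK4r : forall a b, rimp a b = one -> rimp b a = one -> a = b
}.

Inductive bck_symbol := Imp | RImp | BckMeet | BckOne.

Definition bck_sig : signature :=
  @Signature bck_symbol
    (fun s => match s with Imp | RImp | BckMeet => 2 | BckOne => 0 end).

Section PseudoBCKMeet.

Variables (X : Type) (B : structure bck_sig X).

Local Notation "a → b" := (B Imp a b) (at level 55, right associativity).
Local Notation "a ⇝ b" := (B RImp a b) (at level 55, right associativity).
Local Notation "a ∧ b" := (B BckMeet a b) (at level 40, left associativity).
Local Notation "1" := (B BckOne).
Local Notation "a ≤ b" := (a → b = 1) (at level 70, no associativity).

Record pseudo_BCK_meet : Prop := {
  bck_reduct :> pseudo_BCK (B Imp) (B RImp) 1;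
  meet_lbl : forall a b, a ∧ b ≤ a;
  meet_lbr : forall a b, a ∧ b ≤ b;
  meet_glb : forall a b c, c ≤ a -> c ≤ b -> c ≤ a ∧ b
}.

Definition cond_star : Prop :=
  (forall a b c, b → a ≤ (b ∧ c) → (a ∧ c)) /\
  (forall a b c, b ⇝ a ≤ (b ∧ c) ⇝ (a ∧ c)).

Definition pseudo_BCK_meet_star : Prop := pseudo_BCK_meet /\ cond_star.

End PseudoBCKMeet.

(** * The constructions [F] and [G] *)

Definition F_ops {X : Type} (A : structure eq_sig X) : structure bck_sig X :=
  fun s => match s with
  | Imp => fun a b => A Sim (A EqMeet a b) a
  | RImp => fun a b => A BackSim a (A EqMeet a b)
  | BckMeet => fun a b => A EqMeet a b
  | BckOne => A EqOne
  end.

Definition G_ops {X : Type} (B : structure bck_sig X) : structure eq_sig X :=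
  fun s => match s with
  | Sim => fun a b => B Imp b a
  | BackSim => fun a b => B RImp a b
  | EqMeet => fun a b => B BckMeet a b
  | EqOne => B BckOne
  end.

Section FClass.

Variables (X : Type) (A : structure eq_sig X).
Hypothesis PA : pseudo_equality A.

Local Notation "a ∼ b" := (A Sim a b) (at level 50, no associativity).
Local Notation "a ∽ b" := (A BackSim a b) (at level 50, no associativity).
Local Notation "a ∧ b" := (A EqMeet a b) (at level 40, left associativity).
Local Notation "1" := (A EqOne).
Local Notation "a ≤ b" := (a ∧ b = a) (at level 70, no associativity).

Let le_trans b a c : a ≤ b -> b ≤ c -> a ≤ c.
Proof. now intros H K; rewrite <- H, <- (F1_assoc PA), K. Qed.

Let le_antisym a b : a ≤ b -> b ≤ a -> a = b.
Proof. now intros H K; rewrite <- H, (F1_comm PA). Qed.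

Let le_l a b : a ∧ b ≤ a.
Proof. now rewrite (F1_comm PA), (F1_assoc PA), (F1_idem PA). Qed.

Let le_r a b : a ∧ b ≤ b.
Proof. now rewrite <- (F1_assoc PA), (F1_idem PA). Qed.

Let le_meet a b c : c ≤ a -> c ≤ b -> c ≤ a ∧ b.
Proof. now intros H K; rewrite (F1_assoc PA), H. Qed.

Let meet_dup a b c : a ∧ c ∧ (b ∧ c) = a ∧ b ∧ c.
Proof.
rewrite (F1_comm PA b c), !(F1_assoc PA), <- (F1_assoc PA a c c), (F1_idem PA).
now rewrite <- !(F1_assoc PA), (F1_comm PA c b).
Qed.

Let sim_le a x : x ∼ a = 1 -> a ≤ x.
Proof.
intros H; generalize (F6l PA a 1 x).
now rewrite (F3l PA), H, (F3l PA), (F3r PA).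
Qed.

Let bsim_le a x : a ∽ x = 1 -> a ≤ x.
Proof.
intros H; generalize (F6r PA 1 a x).
now rewrite (F3r PA), H, (F3r PA), (F3l PA).
Qed.

Let imp_le a b : (a ∧ b) ∼ a = 1 <-> a ≤ b.
Proof.
split; intros H.
- apply (le_trans (b := a ∧ b)); auto.
- now rewrite H, (F2l PA).
Qed.

Let rimp_le a b : a ∽ (a ∧ b) = 1 <-> a ≤ b.
Proof.
split; intros H.
- apply (le_trans (b := a ∧ b)); auto.
- now rewrite H, (F2r PA).
Qed.

Let meet_mono a b c : a ≤ b -> c ∧ a ≤ c ∧ b.
Proof. intros H; apply le_meet; [|apply (le_trans (b := a))]; auto. Qed.

Let imp_mono a b c : a ≤ b -> (c ∧ a) ∼ c ≤ (c ∧ b) ∼ c.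
Proof. intros H; apply (F4a PA); auto. Qed.

Let rimp_mono a b c : a ≤ b -> c ∽ (c ∧ a) ≤ c ∽ (c ∧ b).
Proof. intros H; apply (F4c PA); auto. Qed.

Let imp_anti a b c : a ≤ b -> (b ∧ c) ∼ b ≤ (a ∧ c) ∼ a.
Proof.
intros H; generalize (F5l PA (b ∧ c) b a).
rewrite (F1_comm PA b a), H, (F1_comm PA (b ∧ c) a), (F1_assoc PA), H.
trivial.
Qed.

Let rimp_anti a b c : a ≤ b -> b ∽ (b ∧ c) ≤ a ∽ (a ∧ c).
Proof.
intros H; generalize (F5r PA b (b ∧ c) a).
rewrite (F1_comm PA b a), H, (F1_comm PA (b ∧ c) a), (F1_assoc PA), H.
trivial.
Qed.

Lemma F_ops_class : pseudo_BCK_meet_star (F_ops A).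
Proof.
split; [constructor; [constructor|..]|split]; simpl; intros.
- apply rimp_le.
  set (u := (a ∧ b ∧ c) ∼ (a ∧ b)).
  set (v := (a ∧ b ∧ c) ∼ a).
  assert (Hv : v ≤ u) by (apply (F4b PA); auto).
  assert (H : (a ∧ b) ∼ a ≤ u ∽ (u ∧ v)).
  { rewrite (F1_comm PA u v), Hv; apply (F6l PA). }
  apply (le_trans H).
  apply (le_trans (b := ((b ∧ c) ∼ b) ∽ (((b ∧ c) ∼ b) ∧ v))).
  + apply rimp_anti; unfold u.
    rewrite <- (F1_assoc PA a b c), (F1_comm PA a (b ∧ c)), (F1_comm PA a b).
    apply (F5l PA).
  + apply rimp_mono, (F4a PA); auto.
    apply le_meet; [|apply (le_r (a ∧ b) c)].
    apply (le_trans (b := a ∧ b)); auto.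
- apply imp_le.
  set (u := (a ∧ b) ∽ (a ∧ b ∧ c)).
  set (v := a ∽ (a ∧ b ∧ c)).
  assert (Hv : v ≤ u) by (apply (F4d PA); auto).
  assert (H : a ∽ (a ∧ b) ≤ (u ∧ v) ∼ u).
  { rewrite (F1_comm PA u v), Hv; apply (F6r PA). }
  apply (le_trans H).
  apply (le_trans (b := ((b ∽ (b ∧ c)) ∧ v) ∼ (b ∽ (b ∧ c)))).
  + apply imp_anti; unfold u.
    rewrite <- (F1_assoc PA a b c), (F1_comm PA a (b ∧ c)), (F1_comm PA a b).
    apply (F5r PA).
  + apply imp_mono, (F4c PA); auto.
    apply le_meet; [|apply (le_r (a ∧ b) c)].
    apply (le_trans (b := a ∧ b)); auto.
- now rewrite (F1_comm PA), (F1_top PA), (F3l PA).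
- now rewrite (F1_comm PA), (F1_top PA), (F3r PA).
- apply imp_le, (F1_top PA).
- apply rimp_le, (F1_top PA).
- now apply le_antisym; apply imp_le.
- now apply le_antisym; apply rimp_le.
- now apply imp_le.
- now apply imp_le.
- now apply imp_le, le_meet; apply imp_le.
- rewrite meet_dup; apply imp_le, (F5l PA).
- rewrite meet_dup; apply imp_le, (F5r PA).
Qed.

End FClass.

Section GClass.

Variables (X : Type) (B : structure bck_sig X).
Hypothesis PB : pseudo_BCK_meet_star B.

Local Notation "a → b" := (B Imp a b) (at level 55, right associativity).
Local Notation "a ⇝ b" := (B RImp a b) (at level 55, right associativity).
Local Notation "a ∧ b" := (B BckMeet a b) (at level 40, left associativity).
Local Notation "1" := (B BckOne).
Local Notation "a ≤ b" := (a → b = 1) (at level 70, no associativity).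

Let P : pseudo_BCK_meet B := proj1 PB.

Let le_rimp a b : a ≤ b <-> a ⇝ b = 1.
Proof.
split; intros H.
- generalize (PBCK1l P 1 a b).
  now rewrite (PBCK2l P), H, (PBCK2l P), (PBCK2r P).
- generalize (PBCK1r P 1 a b).
  now rewrite (PBCK2r P), H, (PBCK2r P), (PBCK2l P).
Qed.

Let le_refl a : a ≤ a.
Proof.
generalize (PBCK1r P 1 1 a).
now rewrite !(PBCK2r P), !(PBCK2l P).
Qed.

Let le_trans b a c : a ≤ b -> b ≤ c -> a ≤ c.
Proof.
intros H K; generalize (PBCK1l P a b c).
now rewrite H, K, !(PBCK2r P).
Qed.

Let le_antisym a b : a ≤ b -> b ≤ a -> a = b.
Proof. exact (PBCK4l P (a := a) (b := b)). Qed.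

Let le_meetE a b : a ∧ b = a <-> a ≤ b.
Proof.
split; intros H.
- rewrite <- H; apply (meet_lbr P).
- apply le_antisym; [apply (meet_lbl P)|].
  now apply (meet_glb P).
Qed.

Let trans1 a b c : a → b ≤ (b → c) ⇝ (a → c).
Proof. apply le_rimp, (PBCK1l P). Qed.

Let trans2 a b c : a ⇝ b ≤ (b ⇝ c) → (a ⇝ c).
Proof. apply (PBCK1r P). Qed.

Let anti1 a b c : a ≤ b -> b → c ≤ a → c.
Proof.
intros H; generalize (trans1 a b c); rewrite H, (PBCK2l P).
apply le_rimp.
Qed.

Let anti2 a b c : a ≤ b -> b ⇝ c ≤ a ⇝ c.
Proof.
intros H; apply le_rimp in H.
generalize (trans2 a b c); now rewrite H, (PBCK2l P).
Qed.

Let mono1 a b c : a ≤ b -> c → a ≤ c → b.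
Proof.
intros H; apply le_rimp; generalize (trans1 c a b).
rewrite H, (PBCK2r P); intros K; now apply le_rimp.
Qed.

Let mono2 a b c : a ≤ b -> c ⇝ a ≤ c ⇝ b.
Proof.
intros H; apply le_rimp in H.
generalize (trans2 c a b); now rewrite H, (PBCK2l P).
Qed.

Let exch12 a b c : a ≤ b → c -> b ≤ a ⇝ c.
Proof.
intros H; apply (le_trans (b := (b → c) ⇝ c)); [|now apply anti2].
generalize (PBCK1l P 1 b c); rewrite !(PBCK2l P); apply le_rimp.
Qed.

Let exch21 a b c : a ≤ b ⇝ c -> b ≤ a → c.
Proof.
intros H; apply (le_trans (b := (b ⇝ c) → c)); [|now apply anti1].
generalize (PBCK1r P 1 b c); now rewrite !(PBCK2r P).
Qed.

Lemma G_ops_class : pseudo_equality (G_ops B).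
Proof.
assert (L := meet_lbl P); assert (R := meet_lbr P); assert (M := meet_glb P).
constructor; simpl; intros;
  repeat match goal with H : ?a ∧ ?b = ?a |- _ => apply le_meetE in H end;
  try apply (proj2 (le_meetE _ _)).
- apply le_antisym; auto.
- apply le_antisym; repeat apply M; auto.
  + apply (le_trans (b := b ∧ c)); auto.
  + apply (le_trans (b := b ∧ c)); auto.
  + apply (le_trans (b := a ∧ b)); auto.
  + apply (le_trans (b := a ∧ b)); auto.
- apply le_refl.
- apply (PBCK3l P).
- apply le_refl.
- apply le_rimp, le_refl.
- apply (PBCK2l P).
- apply (PBCK2r P).
- now apply mono1.
- now apply anti1.
- now apply mono2.
- now apply anti2.
- apply (proj1 (proj2 PB)).
- apply (proj2 (proj2 PB)).
- apply trans1.
- apply trans2.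
- apply exch21, trans1.
- apply exch12, trans2.
Qed.

End GClass.

Definition F {X : Type} (A : algebra pseudo_equality X) :
    algebra pseudo_BCK_meet_star X :=
  Algebra (F_ops_class (in_class A)).

Definition G {X : Type} (B : algebra pseudo_BCK_meet_star X) :
    algebra pseudo_equality X :=
  Algebra (G_ops_class (in_class B)).

Definition invariant {X : Type} (A : algebra pseudo_equality X) : Prop :=
  exists B : algebra pseudo_BCK_meet_star X, G B = A.

Definition invariant_pseudo_equality : algebra_class eq_sig :=
  fun X A => exists PA : pseudo_equality A, invariant (Algebra PA).

Definition cat_B : category := algebra_category pseudo_BCK_meet_star.

Definition cat_InvA : category := algebra_category invariant_pseudo_equality.

(* Main.v *)
From Stdlib Require Import Fin FunctionalExtensionality ProofIrrelevance.
Require Import Defs.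

(** Everything rests on (ii): [F] undoes [G].  Composing them replaces [a → b]
    by [a → (a ∧ b)], so (ii) says that these agree.  One inequality is the
    monotonicity of [→] in its second argument; the other is the instance of
    condition (∗) that meets both sides of [a → b] with [a].

    Parts (i) and (iii) follow formally: (i) is (ii) for the object [F A], and if
    [A = G B] then [G (F A) = G (F (G B)) = G B = A].  Hence [F] and [G] are
    mutually inverse between invariant pseudo equality algebras and pseudo
    BCK-meet-semilattices with (∗).

    The defining formulas of [F] and [G] are terms, so this bijection is a term
    equivalence, which is (iv).  Part (v) is an instance of a general fact:
    homomorphisms preserve the values of terms, so any translation that respects
    two classes of algebras is a functor which is the identity on underlying maps,
    and a term equivalence makes the two functors mutually inverse (lemma
    [term_equivalent_categories]). *)

(** * Term equivalent classes have equivalent categories *)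

Lemma napply_ncurry (X : Type) (n : nat) (g : (Fin.t n -> X) -> X)
    (v : Fin.t n -> X) : napply (ncurry g) v = g v.
Proof.
induction n as [|n IH]; simpl.
- f_equal; apply functional_extensionality_dep; intros i.
  exact (Fin.case0 (fun j => Fin.case0 _ j = v j) i).
- rewrite IH; f_equal; apply functional_extensionality; intros i.
  now pattern i; apply Fin.caseS'.
Qed.

(** Homomorphisms preserve every term operation, not only the fundamental ones;
    this is what makes a translation functorial. *)
Lemma eval_hom (sg : signature) (X Y V : Type) (A : structure sg X)
    (B : structure sg Y) (f : X -> Y) (v : V -> X) (t : term sg V) :
  is_hom A B f -> f (eval A v t) = eval B (fun x => f (v x)) t.
Proof.
intros Hf; induction t as [x|s args IH]; simpl; [reflexivity|].
rewrite Hf; f_equal; apply functional_extensionality; exact IH.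
Qed.

Lemma interpret_hom (sg1 sg2 : signature) (t : translation sg1 sg2)
    (X Y : Type) (A : structure sg2 X) (B : structure sg2 Y) (f : X -> Y) :
  is_hom A B f -> is_hom (interpret t A) (interpret t B) f.
Proof.
intros Hf s v; unfold interpret; rewrite !napply_ncurry.
now apply eval_hom.
Qed.

Section TranslationFunctor.

Variables (sg1 sg2 : signature) (K1 : algebra_class sg1)
  (K2 : algebra_class sg2) (t : translation sg2 sg1).
Hypothesis t_class :
  forall (X : Type) (A : structure sg1 X), K1 X A -> K2 X (interpret t A).

Definition translate_algebra (A : bundled_algebra K1) : bundled_algebra K2 :=
  Bundle (Algebra (t_class (carrier A) A (in_class (bundled A)))).

Definition translate_hom (A B : bundled_algebra K1) (f : algebra_hom A B) :
    algebra_hom (translate_algebra A) (translate_algebra B) :=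
  @AlgebraHom _ _ (translate_algebra A) (translate_algebra B) f
    (interpret_hom _ _ t _ _ _ _ f (hom_funP f)).

Definition translation_functor :
    functor (algebra_category K1) (algebra_category K2).
Proof.
refine (@Functor (algebra_category K1) (algebra_category K2)
  translate_algebra translate_hom _ _);
  intros; now apply algebra_hom_ext.
Defined.

End TranslationFunctor.

Lemma is_hom_id (sg : signature) (X : Type) (A B : structure sg X) :
  A = B -> is_hom A B (fun x => x).
Proof. now intros <-. Qed.

(** A retraction of structures gives natural isomorphisms whose components are
    identity maps: the composite functor changes neither carriers nor, up to
    propositional equality, operations. *)
Lemma translation_functor_retract (sg1 sg2 : signature)
    (K1 : algebra_class sg1) (K2 : algebra_class sg2)
    (t : translation sg2 sg1) (u : translation sg1 sg2)
    (Ht : forall (X : Type) (A : structure sg1 X), K1 X A -> K2 X (interpret t A))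
    (Hu : forall (X : Type) (B : structure sg2 X), K2 X B -> K1 X (interpret u B)) :
  (forall (X : Type) (A : structure sg1 X), K1 X A ->
     interpret u (interpret t A) = A) ->
  inhabited (natural_iso
    (functor_comp (translation_functor _ _ _ _ u Hu)
                  (translation_functor _ _ _ _ t Ht))
    (functor_id (algebra_category K1))).
Proof.
intros Hut; constructor.
set (GF := functor_comp _ _).
pose (E := fun A : algebra_category K1 =>
  Hut (carrier A) A (in_class (bundled A))).
apply (@NaturalIso _ _ GF (functor_id _)
  (fun A => @AlgebraHom _ _ (GF A) A _ (is_hom_id _ _ _ _ (E A)))
  (fun A => @AlgebraHom _ _ A (GF A) _ (is_hom_id _ _ _ _ (eq_sym (E A)))));
  intros; now apply algebra_hom_ext.
Qed.

Theorem term_equivalent_categories (sg1 sg2 : signature)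
    (K1 : algebra_class sg1) (K2 : algebra_class sg2) :
  term_equivalent K1 K2 ->
  equivalent_categories (algebra_category K1) (algebra_category K2).
Proof.
intros (t & u & Ht & Hu & Hut & Htu).
exists (translation_functor _ _ _ _ t Ht), (translation_functor _ _ _ _ u Hu).
now split; apply translation_functor_retract.
Qed.

Lemma term_equivalent_sym (sg1 sg2 : signature)
    (K1 : algebra_class sg1) (K2 : algebra_class sg2) :
  term_equivalent K1 K2 -> term_equivalent K2 K1.
Proof. now intros (t & u & Ht & Hu & Hut & Htu); exists u, t. Qed.

(** * [F] undoes [G] *)

Section FG.

Variables (X : Type) (B : structure bck_sig X).
Hypothesis PB : pseudo_BCK_meet_star B.

Local Notation "a → b" := (B Imp a b) (at level 55, right associativity).
Local Notation "a ⇝ b" := (B RImp a b) (at level 55, right associativity).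
Local Notation "a ∧ b" := (B BckMeet a b) (at level 40, left associativity).
Local Notation "1" := (B BckOne).

Let P : pseudo_BCK_meet B := proj1 PB.

(** (PBCK1) states the transitivity of each arrow as an identity whose outermost
    arrow is the other one, so that using it means passing between the orders
    which the two arrows define. *)
Lemma bck_le_rimp a b : a → b = 1 <-> a ⇝ b = 1.
Proof.
split; intros H.
- generalize (PBCK1l P 1 a b).
  now rewrite (PBCK2l P), H, (PBCK2l P), (PBCK2r P).
- generalize (PBCK1r P 1 a b).
  now rewrite (PBCK2r P), H, (PBCK2r P), (PBCK2l P).
Qed.

Lemma bck_meet_idem a : a ∧ a = a.
Proof. exact (F1_idem (G_ops_class PB) a). Qed.

Lemma bck_meet_comm a b : a ∧ b = b ∧ a.
Proof. exact (F1_comm (G_ops_class PB) a b). Qed.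

Lemma imp_meet a b : a → (a ∧ b) = a → b.
Proof.
apply (PBCK4l P).
- (* [a ∧ b ≤ b], and [→] is monotone in its second argument. *)
  apply bck_le_rimp; generalize (PBCK1l P a (a ∧ b) b).
  now rewrite (meet_lbr P), (PBCK2r P).
- (* Condition (∗) gives [a → b ≤ (a ∧ a) → (b ∧ a)]. *)
  generalize (proj1 (proj2 PB) b a a).
  now rewrite bck_meet_idem, (bck_meet_comm b a).
Qed.

Lemma rimp_meet a b : a ⇝ (a ∧ b) = a ⇝ b.
Proof.
apply (PBCK4l P).
- generalize (PBCK1r P a (a ∧ b) b).
  rewrite (proj1 (bck_le_rimp (a ∧ b) b)); [now rewrite (PBCK2l P)|].
  apply (meet_lbr P).
- generalize (proj2 (proj2 PB) b a a).
  now rewrite bck_meet_idem, (bck_meet_comm b a).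
Qed.

Lemma F_ops_G_ops : F_ops (G_ops B) = B.
Proof.
apply functional_extensionality_dep; intros s; destruct s; simpl;
  try reflexivity;
  apply functional_extensionality; intros a;
  apply functional_extensionality; intros b.
- apply imp_meet.
- apply rimp_meet.
Qed.

End FG.

Lemma algebra_ext (sg : signature) (K : algebra_class sg) (X : Type)
    (A B : algebra K X) : ops A = ops B -> A = B.
Proof.
destruct A as [A PA], B as [B PB]; simpl; intros <-.
now rewrite (proof_irrelevance _ PA PB).
Qed.

Lemma F_G (X : Type) (B : algebra pseudo_BCK_meet_star X) : F (G B) = B.
Proof. apply algebra_ext, F_ops_G_ops, (in_class B). Qed.

Lemma invariantP (X : Type) (A : algebra pseudo_equality X) :
  invariant A <-> G (F A) = A.
Proof.
split.
- now intros [B <-]; rewrite F_G.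
- now intros H; exists (F A).
Qed.

(** * The constructions [F] and [G] as translations *)

Definition vpair {T : Type} (a b : T) : Fin.t 2 -> T :=
  vcons a (vcons b (Fin.case0 (fun _ => T))).

Definition F_terms : translation bck_sig eq_sig :=
  fun s =>
    let x := Var eq_sig (F1 : Fin.t 2) in
    let y := Var eq_sig (FS F1 : Fin.t 2) in
    let meet := @App eq_sig _ EqMeet (vpair x y) in
    match s with
    | Imp => @App eq_sig _ Sim (vpair meet x)
    | RImp => @App eq_sig _ BackSim (vpair x meet)
    | BckMeet => meet
    | BckOne => @App eq_sig _ EqOne (Fin.case0 _)
    end.

Definition G_terms : translation eq_sig bck_sig :=
  fun s =>
    let x := Var bck_sig (F1 : Fin.t 2) in
    let y := Var bck_sig (FS F1 : Fin.t 2) in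
    match s with
    | Sim => @App bck_sig _ Imp (vpair y x)
    | BackSim => @App bck_sig _ RImp (vpair x y)
    | EqMeet => @App bck_sig _ BckMeet (vpair x y)
    | EqOne => @App bck_sig _ BckOne (Fin.case0 _)
    end.

Lemma interpret_F_terms (X : Type) (A : structure eq_sig X) :
  interpret F_terms A = F_ops A.
Proof. now apply functional_extensionality_dep; intros []. Qed.

Lemma interpret_G_terms (X : Type) (B : structure bck_sig X) :
  interpret G_terms B = G_ops B.
Proof. now apply functional_extensionality_dep; intros []. Qed.

Lemma bck_invariant_term_equivalent :
  term_equivalent pseudo_BCK_meet_star invariant_pseudo_equality.
Proof.
exists G_terms, F_terms; split; [|split; [|split]]; intros X.
- intros B PB; rewrite interpret_G_terms.
  now exists (G_ops_class PB), (Algebra PB).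
- intros A [PA _]; rewrite interpret_F_terms; exact (F_ops_class PA).
- intros B PB; rewrite interpret_G_terms, interpret_F_terms.
  now apply F_ops_G_ops.
- intros A [PA HA]; rewrite interpret_F_terms, interpret_G_terms.
  now apply invariantP, (f_equal (fun C => ops C)) in HA.
Qed.

Theorem theorem3p6 :
  (forall (X : Type) (A : algebra pseudo_equality X), F (G (F A)) = F A) /\
  (forall (X : Type) (B : algebra pseudo_BCK_meet_star X), F (G B) = B) /\
  (forall (X : Type) (A : algebra pseudo_equality X),
     invariant A <-> G (F A) = A) /\
  term_equivalent pseudo_BCK_meet_star invariant_pseudo_equality /\
  equivalent_categories cat_InvA cat_B.
Proof.
split; [|split; [|split; [|split]]].
- intros X A; apply F_G.
- exact F_G.
- exact invariantP.
- exact bck_invariant_term_equivalent.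
- apply term_equivalent_categories, term_equivalent_sym.
  exact bck_invariant_term_equivalent.
Qed.
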